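(* Let $m>1$ be an integer and let $\alpha,\beta\in\mathbb{R}$. For every integer $\ell\ge 0$, the generalized Clifford-Jacobi polynomial $G_{\ell,m}^{\alpha,\beta}$ satisfies $$G_{\ell,m}^{\alpha,\beta}(\underline{x})=(-1)^{\ell}\,\omega_{\ell-\alpha,\ell-\beta}(\underline{x})\,\partial_{\underline{x}}^{\ell}\,\omega_{\alpha,\beta}(\underline{x}).$$
   Context: $\mathbb{R}_m$ is the real Clifford algebra generated by an orthonormal basis $e_1,\dots,e_m$ of $\mathbb{R}^m$ with $e_j^2=-1$ and $e_je_k+e_ke_j=0$ for $j\neq k$. A point $x=(x_1,\dots,x_m)\in\mathbb{R}^m$ is identified with the vector $\underline{x}=\sum_{j=1}^m e_jx_j\in\mathbb{R}_m$, so that $\underline{x}^2=-|\underline{x}|^2$. The Dirac operator is $\partial_{\underline{x}}=\sum_{j=1}^m e_j\partial_{x_j}$, acting from the left. Weight: for $\alpha,\beta\in\mathbb{R}$, $\omega_{\alpha,\beta}(\underline{x})=(1-\underline{x})^{\alpha}(1+\underline{x})^{\beta}$. Real powers of $1\pm\underline{x}$ are given by the binomial series in $\underline{x}$ for $|\underline{x}|<1$. For general $\underline{x}=r\underline{\omega}$ with $r=|\underline{x}|$ and $|\underline{\omega}|=1$, they are principal powers computed in the commutative subalgebra $\mathbb{R}+\mathbb{R}\underline{\omega}\cong\mathbb{C}$, where $1\pm r\underline{\omega}$ has real part $1$. Generalized Clifford-Jacobi polynomials: the functions $G_{\ell,m}^{\alpha,\beta}$, $\ell\ge 0$, are defined by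 $G_{0,m}^{\alpha,\beta}=1$ and the requirement that $$F^*(t,\underline{x})=\sum_{\ell=0}^{\infty}\frac{t^\ell}{\ell!}\,G_{\ell,m}^{\alpha,\beta}(\underline{x})\,\omega_{\alpha-\ell,\beta-\ell}(\underline{x})$$ be monogenic, i.e. $(\partial_t+\partial_{\underline{x}})F^*(t,\underline{x})=0$, with $t$ a real variable and the equation understood coefficientwise in powers of $t$. *)

(* Defs.v *)
From HB Require Import structures.
From mathcomp Require Import all_boot all_order all_algebra.
From mathcomp Require Import ring.
From mathcomp Require Import all_classical all_reals all_analysis.

Set Implicit Arguments.
Unset Strict Implicit.
Unset Printing Implicit Defensive.

Import Order.TTheory GRing.Theory Num.Theory.
Import numFieldNormedType.Exports.
Local Open Scope ring_scope.

(* The Clifford algebra R_m, by coordinates on the basis e_A = e_{i_1} ... e_{i_k},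
   A = {i_1 < ... < i_k}.  Indices run over 0..m-1 instead of 1..m. *)
Definition clifford (R : comNzRingType) (m : nat) : Type :=
  {ffun {set 'I_m} -> R}.

Section CliffordAlgebra.
Context (R : comNzRingType) (m : nat).
Local Notation Cl := (clifford R m).

HB.instance Definition _ := Choice.copy Cl {ffun {set 'I_m} -> R}.
HB.instance Definition _ := GRing.Lmodule.copy Cl {ffun {set 'I_m} -> R^o}.

Definition symdiff (A B : {set 'I_m}) : {set 'I_m} :=
  [set i | (i \in A) (+) (i \in B)]%SET.

(* e_A e_B = cl_sign A B * e_(symdiff A B): moving e_j (j in B) to its place in
   e_A produces one factor -1 for each i in A with i > j, and, if j is in A,
   one more factor -1 from e_j e_j = -1. *)
Definition cl_sign (A B : {set 'I_m}) : R :=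
  \prod_(i in A) \prod_(j in B | (j <= i)%N) -1.

Definition cl_basis (A : {set 'I_m}) : Cl := [ffun B => (B == A)%:R].

Definition cl_mul (x y : Cl) : Cl :=
  [ffun C => \sum_A \sum_(B | symdiff A B == C) cl_sign A B * (x A * y B)].

Lemma symdiffA A B C : symdiff A (symdiff B C) = symdiff (symdiff A B) C.
Proof. by apply/setP => i; rewrite !inE addbA. Qed.

Lemma symdiffC A B : symdiff A B = symdiff B A.
Proof. by apply/setP => i; rewrite !inE addbC. Qed.

Lemma symdiffK A B : symdiff A (symdiff A B) = B.
Proof. by apply/setP => i; rewrite !inE addbA addbb. Qed.

Lemma symdiff0s A : symdiff finset.set0 A = A.
Proof. by apply/setP => i; rewrite !inE. Qed.

Lemma symdiffs0 A : symdiff A finset.set0 = A.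
Proof. by apply/setP => i; rewrite !inE addbF. Qed.

Lemma symdiff_eq A B C : (symdiff A B == C) = (B == symdiff A C).
Proof. by apply/eqP/eqP => [<-|->]; rewrite symdiffK. Qed.

Lemma cl_signE A B : cl_sign A B =
  \prod_i \prod_(j : 'I_m) (-1) ^+ [&& i \in A, j \in B & (j <= i)%N].
Proof.
rewrite /cl_sign big_mkcond; apply: eq_bigr => i _.
case: (i \in A) => /=; last by rewrite big1.
by rewrite big_mkcond; apply: eq_bigr => j _; case: ifP.
Qed.

Lemma cl_signDl A B C : cl_sign (symdiff A B) C = cl_sign A C * cl_sign B C.
Proof.
rewrite !cl_signE -big_split; apply: eq_bigr => i _.
rewrite -big_split; apply: eq_bigr => j _; rewrite !inE.
by case: (i \in A); case: (i \in B); case: ((j \in C) && _);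
  rewrite /= ?mulr1 ?mul1r ?mulrNN ?mulr1.
Qed.

Lemma cl_signDr A B C : cl_sign C (symdiff A B) = cl_sign C A * cl_sign C B.
Proof.
rewrite !cl_signE -big_split; apply: eq_bigr => i _.
rewrite -big_split; apply: eq_bigr => j _; rewrite !inE.
by case: (i \in C); case: (j \in A); case: (j \in B); case: (j <= i)%N;
  rewrite /= ?mulr1 ?mul1r ?mulrNN ?mulr1.
Qed.

Lemma cl_sign0s A : cl_sign finset.set0 A = 1.
Proof. by rewrite /cl_sign big1 // => i; rewrite inE. Qed.

Lemma cl_signs0 A : cl_sign A finset.set0 = 1.
Proof.
by rewrite /cl_sign big1 // => i _; rewrite big1 // => j; rewrite inE.
Qed.

Lemma cl_mulE x y C : cl_mul x y C =
  \sum_A cl_sign A (symdiff A C) * (x A * y (symdiff A C)).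
Proof.
rewrite ffunE; apply: eq_bigr => A _.
by rewrite (eq_bigl _ _ (fun B => symdiff_eq A B C)) big_pred1_eq.
Qed.

Lemma cl_mulA : associative cl_mul.
Proof.
move=> x y z; apply/ffunP => D; rewrite !cl_mulE.
under eq_bigr => A _ do rewrite cl_mulE !mulr_sumr.
under [RHS]eq_bigr => C _ do rewrite cl_mulE mulr_suml mulr_sumr.
rewrite [RHS]exchange_big /=; apply: eq_bigr => A _.
rewrite [RHS](reindex_inj (can_inj (symdiffK A))); apply: eq_bigr => B _ /=.
rewrite symdiffK (_ : symdiff (symdiff A B) D = symdiff B (symdiff A D)).
  rewrite cl_signDl -[X in cl_sign A X * _](symdiffK B (symdiff A D)).
  rewrite [in LHS]cl_signDr; set z' := z _; set v := cl_sign A (symdiff B _).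
  by ring.
by rewrite symdiffA (symdiffC B).
Qed.

Lemma cl_mul1l : left_id (cl_basis finset.set0) cl_mul.
Proof.
move=> x; apply/ffunP => C; rewrite cl_mulE (bigD1 finset.set0) //= big1.
  by rewrite ffunE eqxx symdiff0s cl_sign0s !mul1r addr0.
by move=> A /negbTE An0; rewrite ffunE An0 mul0r mulr0.
Qed.

Lemma cl_mul1r : right_id (cl_basis finset.set0) cl_mul.
Proof.
move=> x; apply/ffunP => C; rewrite cl_mulE (bigD1 C) //= big1.
  rewrite ffunE (_ : symdiff C C = finset.set0) ?eqxx ?cl_signs0 ?mul1r ?mulr1 ?addr0 //.
  by apply/setP => i; rewrite !inE addbb.
by move=> A nAC; rewrite ffunE symdiff_eq symdiffs0 eq_sym (negbTE nAC) !mulr0.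
Qed.

Lemma cl_mulDl : left_distributive cl_mul (@GRing.add Cl).
Proof.
move=> x y z; apply/ffunP => C; rewrite [RHS]ffunE !cl_mulE -big_split.
by apply: eq_bigr => A _; rewrite /= ffunE mulrDl mulrDr.
Qed.

Lemma cl_mulDr : right_distributive cl_mul (@GRing.add Cl).
Proof.
move=> x y z; apply/ffunP => C; rewrite [RHS]ffunE !cl_mulE -big_split.
by apply: eq_bigr => A _; rewrite /= ffunE !mulrDr.
Qed.

Lemma cl_1_neq0 : cl_basis finset.set0 != 0.
Proof.
apply/eqP => /ffunP /(_ finset.set0); rewrite !ffunE eqxx => /eqP.
by rewrite oner_eq0.
Qed.

HB.instance Definition _ := GRing.Zmodule_isNzRing.Build Cl
  cl_mulA cl_mul1l cl_mul1r cl_mulDl cl_mulDr cl_1_neq0.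

Lemma cl_scaleAl (a : R) (x y : Cl) : a *: (x * y) = (a *: x) * y.
Proof.
apply/ffunP => C; rewrite ffunE !cl_mulE scaler_sumr; apply: eq_bigr => A _.
by rewrite ffunE /GRing.scale /=; ring.
Qed.

HB.instance Definition _ := GRing.Lmodule_isLalgebra.Build R Cl cl_scaleAl.

Lemma cl_scaleAr (a : R) (x y : Cl) : a *: (x * y) = x * (a *: y).
Proof.
apply/ffunP => C; rewrite ffunE !cl_mulE scaler_sumr; apply: eq_bigr => A _.
by rewrite ffunE /GRing.scale /=; ring.
Qed.

HB.instance Definition _ := GRing.Lalgebra_isAlgebra.Build R Cl cl_scaleAr.

Lemma cl_basisM A B :
  cl_basis A * cl_basis B = cl_sign A B *: cl_basis (symdiff A B).
Proof.
apply/ffunP => C; rewrite [LHS]cl_mulE (bigD1 A) //= big1 => [|D /negbTE DA].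
  rewrite addr0 !ffunE eqxx mul1r [RHS]/GRing.scale /= symdiff_eq.
  by case: (C =P _) => [->|_]; rewrite ?symdiffK ?mulr0.
by rewrite ffunE DA mul0r mulr0.
Qed.

Definition cl_gen (j : 'I_m) : Cl := cl_basis [set j]%SET.

Lemma cl_sign11 i j : cl_sign [set i]%SET [set j]%SET = (-1) ^+ (j <= i)%N.
Proof.
rewrite /cl_sign big_set1; case: (leqP j i) => ji.
  by rewrite (big_pred1 j) // => k; rewrite /= !inE;
     case: eqP => [->|]; rewrite ?ji.
rewrite big1 // => k; rewrite !inE => /andP[/eqP-> ].
by rewrite leqNgt ji.
Qed.

Lemma cl_gen_sqr j : cl_gen j * cl_gen j = -1.
Proof.
rewrite cl_basisM cl_sign11 leqnn scaleN1r (_ : symdiff _ _ = finset.set0) //.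
by apply/setP => i; rewrite !inE addbb.
Qed.

Lemma cl_gen_anticomm j k : j != k ->
  cl_gen j * cl_gen k + cl_gen k * cl_gen j = 0.
Proof.
move=> jk; rewrite !cl_basisM !cl_sign11.
have -> : symdiff [set k]%SET [set j]%SET = symdiff [set j]%SET [set k]%SET.
  by apply/setP => i; rewrite !inE addbC.
rewrite -scalerDl; case: (ltngtP j k) => [_|_|/val_inj jkE].
- by rewrite expr0 expr1 addrN scale0r.
- by rewrite expr0 expr1 addNr scale0r.
- by rewrite jkE eqxx in jk.
Qed.

End CliffordAlgebra.

Section CliffordJacobi.
Context (R : realType) (m : nat).
Local Notation Cl := (clifford R m).
Local Notation pt := ('rV[R]_m).

Definition cl_vec (x : pt) : Cl := \sum_(j < m) x 0 j *: cl_gen R j.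

(* The Euclidean norm; the norm `|x| of 'rV[R]_m is the sup norm. *)
Definition enorm (x : pt) : R := Num.sqrt (\sum_(j < m) x 0 j ^+ 2).

Lemma cl_vec_sqr (x : pt) : cl_vec x * cl_vec x = - (enorm x ^+ 2)%:A.
Proof.
have -> : cl_vec x * cl_vec x = \sum_(i < m) \sum_(j < m)
    (x 0 i * x 0 j) *: (cl_gen R i * cl_gen R j).
  rewrite /cl_vec mulr_suml; apply: eq_bigr => i _.
  rewrite mulr_sumr; apply: eq_bigr => j _.
  by rewrite -scalerAl -scalerAr scalerA.
set S := (LHS); have two0 : (2 : R) != 0 by rewrite pnatr_eq0.
apply: (scalerI two0); rewrite !scaler_nat !mulr2n {2}/S exchange_big -big_split.
rewrite sqr_sqrtr ?sumr_ge0 // => [|i _]; last exact: sqr_ge0.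
rewrite -opprD -scalerDl -big_split scaler_suml -sumrN; apply: eq_bigr => i _ /=.
rewrite -big_split (bigD1 i) //= big1 => [|j ji].
  by rewrite addr0 cl_gen_sqr -scalerDl scalerN -expr2.
by rewrite [x 0 j * _]mulrC -scalerDr cl_gen_anticomm ?scaler0 // eq_sym.
Qed.

(* d/dx_j, coordinatewise on the basis e_A. *)
Definition partial (j : 'I_m) (f : pt -> Cl) (x : pt) : Cl :=
  [ffun A => 'D_('e_j) (fun y => f y A) x].

Definition dirac_op (f : pt -> Cl) (x : pt) : Cl :=
  \sum_(j < m) cl_gen R j * partial j f x.

(* The principal power (1 + b w)^a in R + R w, where w plays the role of the
   imaginary unit: |1 + b w| = sqrt (1 + b^2) and Arg (1 + b w) = atan b. *)
Definition ppow (w : Cl) (b a : R) : Cl :=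
  ((1 + b ^+ 2) `^ (a / 2)) *:
    ((cos (a * atan b))%:A + sin (a * atan b) *: w).

(* At x = 0 the direction is 0, which is harmless since then b = 0. *)
Definition direction (x : pt) : Cl := cl_vec ((enorm x)^-1 *: x).

Definition weight (a b : R) (x : pt) : Cl :=
  ppow (direction x) (- enorm x) a * ppow (direction x) (enorm x) b.

Lemma direction_sqr (x : pt) :
  enorm x = 0 \/ direction x * direction x = -1.
Proof.
case: (eqVneq (enorm x) 0) => [|x0]; [by left | right].
have -> : direction x = (enorm x)^-1 *: cl_vec x.
  by rewrite /direction /cl_vec scaler_sumr; apply: eq_bigr => j _;
     rewrite mxE scalerA.
rewrite -scalerAl -scalerAr cl_vec_sqr !scalerN !scalerA.
by rewrite expr2 mulrA mulrVK ?unitfE // mulVf // scale1r.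
Qed.

Lemma ppow_comm (w : Cl) (b b' a a' : R) :
  ppow w b a * ppow w b' a' = ppow w b' a' * ppow w b a.
Proof.
have c1 (u : Cl) (r s : R) : GRing.comm u w -> GRing.comm u (r%:A + s *: w).
  move=> uw; apply: commrD; first by rewrite /GRing.comm -scalerAl -scalerAr mulr1 mul1r.
  by rewrite /GRing.comm -scalerAl -scalerAr uw.
rewrite /ppow -!scalerAl -!scalerAr !scalerA [_ `^ _ * _]mulrC; congr (_ *: _).
by apply: (c1); apply/commr_sym/c1.
Qed.

Lemma ppowN (w : Cl) (b a : R) : b = 0 \/ w * w = -1 ->
  ppow w b a * ppow w b (- a) = 1.
Proof.
have b1 : 0 < 1 + b ^+ 2 by rewrite ltr_pwDl // sqr_ge0.
case=> [->|w2].
  rewrite /ppow atan0 !mulr0 sin0 cos0 !scale0r !addr0 expr0n addr0 !powR1.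
  by rewrite !scale1r mulr1.
rewrite /ppow -scalerAl -scalerAr scalerA -powRD; last first.
  by rewrite (gt_eqF b1) implybT.
rewrite mulNr subrr powRr0 scale1r mulNr cosN sinN.
set c := cos _; set d := sin _.
rewrite mulrDl !mulrDr -!scalerAl -!scalerAr !mul1r !mulr1 w2 !scalerA.
rewrite addrA -[X in X + _]addrA -scalerDl mulrN [d * c]mulrC addNr scale0r addr0.
by rewrite mulrN scalerN scaleNr opprK -scalerDl -!expr2 cos2Dsin2 scale1r.
Qed.

Lemma weightN (a b : R) (x : pt) : weight a b x * weight (- a) (- b) x = 1.
Proof.
have [r0|w2] := direction_sqr x;
by rewrite /weight -mulrA [X in _ * X]mulrA [X in _ * (X * _)]ppow_comm -!mulrA
  ppowN ?mulr1 ?ppowN //; rewrite ?r0 ?oppr0; auto.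
Qed.

(* Formal power series in t with coefficients functions of x: F l is the
   coefficient of t^l. *)
Definition dt_series (F : nat -> pt -> Cl) (l : nat) (x : pt) : Cl :=
  l.+1%:R *: F l.+1 x.

Definition dirac_series (F : nat -> pt -> Cl) (l : nat) (x : pt) : Cl :=
  dirac_op (F l) x.

Definition monogenic (F : nat -> pt -> Cl) : Prop :=
  forall l x, dt_series F l x + dirac_series F l x = 0.

Definition Fstar (G : nat -> pt -> Cl) (a b : R) (l : nat) (x : pt) : Cl :=
  (l`!%:R)^-1 *: (G l x * weight (a - l%:R) (b - l%:R) x).

Definition clifford_jacobi (a b : R) (G : nat -> pt -> Cl) : Prop :=
  (forall x, G 0%N x = 1) /\ monogenic (Fstar G a b).

Lemma clifford_jacobi_exists (a b : R) : exists G, clifford_jacobi a b G.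
Proof.
pose c := fix c l : pt -> Cl := if l is k.+1
  then fun x => - (k.+1%:R^-1 *: dirac_op (c k) x) else weight a b.
pose G l x := l`!%:R *: (c l x * weight (l%:R - a) (l%:R - b) x).
have FE l : Fstar G a b l = c l.
  apply: funext => x; rewrite /Fstar /G -scalerAl scalerA mulVf ?scale1r; last first.
    by rewrite pnatr_eq0 -lt0n fact_gt0.
  have := weightN (l%:R - a) (l%:R - b) x; rewrite !opprB => wN.
  by rewrite -mulrA wN mulr1.
exists G; split=> [x|l x].
  by rewrite /G /= !sub0r scale1r weightN.
rewrite /dt_series /dirac_series !FE /= scalerN scalerA mulfV ?pnatr_eq0 //.
by rewrite scale1r addNr.
Qed.

End CliffordJacobi.

(* Main.v *)
Require Import Defs.
From mathcomp Require Import all_boot all_order all_algebra.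
From mathcomp Require Import ring.
From mathcomp Require Import all_classical all_reals all_analysis.
Import Order.TTheory GRing.Theory Num.Theory.
Import numFieldNormedType.Exports.
Local Open Scope ring_scope.

(** Read coefficientwise in [t], monogenicity is the recursion
    [(l + 1) F_(l+1) = - dirac_op F_l] for the coefficients [F_l] of the series;
    since [F_0] is the weight, [F_l] is [(-1)^l / l!] times the [l]-th iterate of
    the Dirac operator on the weight.  Hence [G_l] times the weight of exponents
    [alpha - l], [beta - l] equals [(-1)^l] times that iterate
    ([clifford_jacobi_weighted]).  Multiplying on the right by the inverse weight
    gives Rodrigues' formula, except that the weight stands to the right of the
    iterate.

    Moving it to the left is the real content, because the Clifford algebra is
    not commutative.  Away from the origin the weight is axial: it has the form
    [a(r) + b(r) x] with [r] the norm of the vector [x] and [a], [b] real-valued.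
    Two such values at the same [x] commute ([mul_axial]).  The Dirac operator
    preserves this form ([axial_dirac]),
<<
      dirac_op (a(r) + b(r) x) = - (r b'(r) + m b(r)) + (a'(r) / r) x,
>>
    so each iterate is axial and commutes with every weight.  At the origin
    the weight equals 1 and commutes with anything ([weight_comm_axial]).

    To iterate [axial_dirac] the profiles [a], [b] need derivatives of all orders
    on the positive half-line.  They are kept in an explicit class of elementary
    functions closed under differentiation ([profile_derive]). *)

(** * Radial profiles *)

Section RadialProfiles.
Set Implicit Arguments.
Unset Strict Implicit.
Context {R : realType}.

(** The functions of [r] that occur as coefficients of the iterates: [r^-1] comes
    from the derivative of the norm, the other generators from the modulus and
    the argument of the principal powers of [1 + r w] and [1 - r w]. *)
Inductive profile : (R -> R) -> Prop :=
| profile_cst c : profile (fun=> c)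
| profile_id : profile id
| profile_inv : profile (fun r => r^-1)
| profile_pow a : profile (fun r => (1 + r ^+ 2) `^ a)
| profile_cos a : profile (fun r => cos (a * atan r))
| profile_sin a : profile (fun r => sin (a * atan r))
| profileD f g : profile f -> profile g -> profile (fun r => f r + g r)
| profileM f g : profile f -> profile g -> profile (fun r => f r * g r).

Lemma is_derive_atanM (a r : R) :
  is_derive r 1 (fun s => a * atan s) (a * (1 + r ^+ 2) `^ (-1)).
Proof.
rewrite powRN powRr1 ?addr_ge0 ?sqr_ge0 //.
have d := @is_deriveZ R R R atan a r 1 _ (is_derive1_atan r).
exact: d.
Qed.

(** The derivative is again in the class, so one application of the lemma per
    derivative replaces a theory of smooth functions. *)
Lemma profile_derive (f : R -> R) : profile f ->
  exists2 g, profile g & forall r : R, 0 < r -> is_derive r 1 f (g r).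
Proof.
elim=> {f} [c||| a | a | a | f g _ [f' rf' df] _ [g' rg' dg]
                     | f g rf [f' rf' df] rg [g' rg' dg]].
- by exists (fun=> 0) => [|r _]; [exact: profile_cst | exact: is_derive_cst].
- by exists (fun=> 1) => [|r _]; [exact: profile_cst | exact: is_derive_id].
- exists (fun r => -1 * (r^-1 * r^-1)) => [|r r0].
    by do !apply: profileM; solve [exact: profile_cst | exact: profile_inv].
  have r1 : r != 0 by rewrite gt_eqF.
  have d := @is_deriveV R id r 1 1 r1 (is_derive_id r 1).
  apply: is_derive_eq d _.
  by rewrite /= [_ *: _]mulr1 mulN1r expr2 invfM.
- exists (fun r => a * (1 + r ^+ 2) `^ (a - 1) * (2 * r)) => [|r r0].
    apply: profileM; apply: profileM;
      solve [exact: profile_cst | exact: profile_pow | exact: profile_id].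
  have p : 0 < 1 + r ^+ 2 by rewrite ltr_pwDl // sqr_ge0.
  have d2 := @is_deriveX R R id 2 r 1 1 (is_derive_id r 1).
  have d1 : is_derive r 1 (fun s : R => 1 + s ^+ 2) _ :=
    is_deriveD (is_derive_cst (1 : R) r (1 : R)) d2.
  have d : is_derive r 1 (fun s : R => (1 + s ^+ 2) `^ a) _ :=
    @is_derive1_comp R (fun y => y `^ a) (fun s => 1 + s ^+ 2) r _ _
      (is_derive1_powR a p) d1.
  apply: is_derive_eq d _.
  by rewrite /= add0r expr1 [_ *: _]mulr1.
- exists (fun r => -1 * sin (a * atan r) * (a * (1 + r ^+ 2) `^ (-1))) => [|r _].
    apply: profileM; apply: profileM;
      solve [exact: profile_cst | exact: profile_pow | exact: profile_sin].
  have d : is_derive r 1 (fun s => cos (a * atan s)) _ :=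
    @is_derive1_comp R cos _ r _ _ (is_derive_cos _) (is_derive_atanM a r).
  apply: is_derive_eq d _.
  by rewrite mulN1r.
- exists (fun r => cos (a * atan r) * (a * (1 + r ^+ 2) `^ (-1))) => [|r _].
    by apply: profileM; [exact: profile_cos|apply: profileM];
      solve [exact: profile_cst | exact: profile_pow].
  exact: (@is_derive1_comp R sin _ r _ _ (is_derive_sin _) (is_derive_atanM a r)).
- exists (fun r => f' r + g' r) => [|r r0]; first exact: profileD.
  exact: is_deriveD (df r r0) (dg r r0).
- exists (fun r => f r * g' r + g r * f' r) => [|r r0].
    by apply: profileD; exact: profileM.
  exact: is_deriveM (df r r0) (dg r r0).
Qed.

End RadialProfiles.

(** * Derivatives along coordinate lines *)

Section AxialFunctions.
Set Implicit Arguments.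
Unset Strict Implicit.
Context {R : realType} {m : nat}.
Local Notation Cl := (clifford R m).
Local Notation pt := ('rV[R]_m).
Implicit Types (f g : pt -> Cl) (x : pt).

(** In one real variable the chain rule needs directional data only, whereas in
    several variables it would need full differentiability. *)
Lemma derive_line (f : pt -> R) x v (d : R) :
  is_derive (0 : R) 1 (fun h : R => f (h *: v + x)) d -> 'D_v f x = d.
Proof.
move=> [_ <-]; rewrite /derive.
set q1 := fun h => h^-1 *: _; set q2 := fun h => h^-1 *: _.
suff -> : q1 = q2 by [].
by apply: funext => h; rewrite /q1 /q2 /= addr0 scale0r add0r [_%:A]mulr1.
Qed.

Lemma enorm_sqr x : enorm x ^+ 2 = \sum_(i < m) x 0 i ^+ 2.
Proof. by rewrite sqr_sqrtr // sumr_ge0 // => i _; exact: sqr_ge0. Qed.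

Lemma enorm_line x j (h : R) :
  enorm (h *: 'e_j + x) = Num.sqrt (enorm x ^+ 2 + h * (2 * x 0 j + h)).
Proof.
rewrite enorm_sqr /enorm; congr Num.sqrt.
rewrite (bigD1 j) //= [in RHS](bigD1 j) //= !mxE !eqxx mulr1.
rewrite (eq_bigr (fun i => x 0 i ^+ 2)); first by ring.
by move=> i ij; rewrite !mxE (negbTE ij) andbF mulr0 add0r.
Qed.

Lemma is_derive_enorm_sqr_line x j :
  is_derive (0 : R) 1 (fun h : R => enorm x ^+ 2 + h * (2 * x 0 j + h))
    (2 * x 0 j).
Proof.
have di := is_derive_id (0 : R) (1 : R).
have d := is_deriveD (is_derive_cst (enorm x ^+ 2) (0 : R) (1 : R))
  (is_deriveM di (is_deriveD (is_derive_cst (2 * x 0 j) (0 : R) (1 : R)) di)).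
apply: is_derive_eq d _.
by rewrite scale0r !add0r [_ *: _]mulr1 [LHS]addr0.
Qed.

Lemma is_derive_enorm_line x j : 0 < enorm x ->
  is_derive (0 : R) 1 (fun h : R => enorm (h *: 'e_j + x)) (x 0 j / enorm x).
Proof.
move=> x0; pose q (h : R) := enorm x ^+ 2 + h * (2 * x 0 j + h).
rewrite (_ : (fun h => _) = Num.sqrt \o q); last first.
  by apply: funext => h; rewrite enorm_line.
have q0 : 0 < q 0 by rewrite /q mul0r addr0 exprn_gt0.
have d := @is_derive1_comp R Num.sqrt q 0 _ _ (is_derive1_sqrt q0)
  (is_derive_enorm_sqr_line x j).
apply: is_derive_eq d _; rewrite /q.
rewrite mul0r addr0 sqrtr_sqr gtr0_norm // invfM.
by rewrite mulrACA mulVf ?pnatr_eq0 // mul1r mulrC.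
Qed.

(** An axial expansion is only available off the origin; this lets it be
    differentiated along a line. *)
Lemma near_line_enorm_gt0 x j : 0 < enorm x ->
  \forall h \near (0 : R), 0 < enorm (h *: 'e_j + x).
Proof.
move=> x0.
have [/derivable1_diffP/differentiable_continuous c _] :=
  is_derive_enorm_line j x0.
have e0 : 0 < enorm (0 *: 'e_j + x) by rewrite scale0r add0r.
exact: (@cvgr_gt _ _ _ _ _ _ c 0 e0).
Qed.

(** * Axial functions *)

Definition axial_form (a b : R -> R) x : Cl :=
  (a (enorm x))%:A + b (enorm x) *: cl_vec x.

(** Nothing is asked at the origin, where the profiles may be singular. *)
Definition axial f := exists a b, [/\ profile a, profile b &
  forall x, 0 < enorm x -> f x = axial_form a b x].

Lemma cl_vecD x y : cl_vec (x + y) = cl_vec x + cl_vec y :> Cl.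
Proof.
by rewrite /cl_vec -big_split; apply: eq_bigr => i _; rewrite mxE scalerDl.
Qed.

Lemma cl_vecZ (c : R) x : cl_vec (c *: x) = c *: cl_vec x :> Cl.
Proof.
by rewrite /cl_vec scaler_sumr; apply: eq_bigr => i _; rewrite mxE scalerA.
Qed.

Lemma cl_vec_delta j : cl_vec 'e_j = cl_gen R j :> Cl.
Proof.
rewrite /cl_vec (bigD1 j) //= big1 => [|i ij].
  by rewrite !mxE !eqxx scale1r addr0.
by rewrite !mxE (negbTE ij) andbF scale0r.
Qed.

Lemma cl_coordD (u v : Cl) A : (u + v) A = u A + v A.
Proof. by rewrite ffunE. Qed.

Lemma cl_coordZ (c : R) (u : Cl) A : (c *: u) A = c * u A.
Proof. by rewrite ffunE. Qed.

Lemma is_derive_axial_line (a b N : R -> R) (a' b' n u v w : R) :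
    is_derive (N 0) 1 a a' -> is_derive (N 0) 1 b b' -> is_derive (0 : R) 1 N n ->
  is_derive (0 : R) 1 (fun h => a (N h) * u + b (N h) * (h * v + w))
    (a' * n * u + (b' * n * w + b (N 0) * v)).
Proof.
move=> da db dN.
have daN := is_derive1_comp da dN.
have dbN := is_derive1_comp db dN.
have dc (c : R) : is_derive (0 : R) (1 : R) (cst c) 0 by exact: is_derive_cst.
have dV : is_derive (0 : R) 1 (fun h => h * v + w) _ :=
  is_deriveD (is_deriveM (is_derive_id (0 : R) 1) (dc v)) (dc w).
have d : is_derive (0 : R) 1 (fun h => a (N h) * u + b (N h) * (h * v + w)) _ :=
  is_deriveD (is_deriveM daN (dc u)) (is_deriveM dbN dV).
apply: is_derive_eq d _.
rewrite /= !scaler0 mul0r !add0r addr0 /GRing.scale /=; ring.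
Qed.

Lemma partial_axial_form f (a b a' b' : R -> R) x j : 0 < enorm x ->
    (forall y, 0 < enorm y -> f y = axial_form a b y) ->
    is_derive (enorm x) 1 a (a' (enorm x)) ->
    is_derive (enorm x) 1 b (b' (enorm x)) ->
  partial j f x = (a' (enorm x) * (x 0 j / enorm x))%:A
    + ((b' (enorm x) * (x 0 j / enorm x)) *: cl_vec x
       + b (enorm x) *: cl_gen R j).
Proof.
move=> x0 fE da db; apply/ffunP => A; rewrite ffunE; apply: derive_line.
pose N (h : R) := enorm (h *: 'e_j + x).
have N0 : N 0 = enorm x by rewrite /N scale0r add0r.
have dN : is_derive (0 : R) 1 N (x 0 j / enorm x) by exact: is_derive_enorm_line.
rewrite !cl_coordD !cl_coordZ -N0 in da db dN *.
apply: near_eq_is_derive; last first.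
  exact: is_derive_axial_line da db dN.
near=> h.
rewrite fE /axial_form; last by near: h; exact: near_line_enorm_gt0.
by rewrite cl_vecD cl_vecZ cl_vec_delta !cl_coordD !cl_coordZ cl_coordD cl_coordZ.
Unshelve. all: by end_near. Qed.

(** The partial derivatives are [(a' + b' x) x_j / r + b e_j].  Summed against
    [e_j] on the left, the factors [e_j x_j] recombine into [x], with
    [x^2 = - r^2], and the squares [e_j^2 = -1] contribute [- m b]. *)
Lemma axial_dirac f : axial f -> axial (dirac_op f).
Proof.
case=> a [b] [ra rb fE].
have [a' ra' da] := profile_derive ra; have [b' rb' db] := profile_derive rb.
exists (fun r => -1 * (b' r * r) + - m%:R * b r), (fun r => a' r * r^-1); split.
- apply: profileD; apply: profileM; [| |exact: profile_cst|exact: rb].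
    exact: profile_cst.
  by apply: profileM; [exact: rb' | exact: profile_id].
- by apply: profileM; [exact: ra' | exact: profile_inv].
move=> x x0; rewrite /dirac_op.
under eq_bigr => j _ do
  rewrite (partial_axial_form j x0 fE (da _ x0) (db _ x0)) !mulrDr
    -!(scalerAr _ (cl_gen R j)).
rewrite !big_split /=.
under [X in _ + (_ + X)]eq_bigr => j _ do rewrite cl_gen_sqr.
rewrite sumr_const card_ord.
rewrite (_ : \sum_j _ = (a' (enorm x) / enorm x) *: cl_vec x); last first.
  rewrite /cl_vec scaler_sumr; apply: eq_bigr => j _.
  by rewrite mulr1 scalerA mulrA mulrAC.
rewrite (_ : \sum_j _ = (b' (enorm x) / enorm x) *: (cl_vec x * cl_vec x));
  last first.
  rewrite {2}/cl_vec mulr_suml scaler_sumr; apply: eq_bigr => j _.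
  by rewrite -(scalerAl _ (cl_gen R j)) scalerA mulrA mulrAC.
rewrite cl_vec_sqr /axial_form addrC; congr (_ + _).
rewrite scalerN scalerA !scalerN -scaler_nat scalerN scalerA -!scaleNr -scalerDl.
by congr (_%:A); rewrite /GRing.scale /=; field; rewrite gt_eqF.
Qed.

(** Since [x^2 = - r^2] is a scalar, the elements [a + b x] multiply as in a
    quadratic extension of the reals; the right-hand side is symmetric in the two
    factors, so they commute. *)
Lemma mul_axial (a b c d : R) x :
  (a%:A + b *: cl_vec x : Cl) * (c%:A + d *: cl_vec x)
    = (a * c - b * d * enorm x ^+ 2)%:A + (a * d + b * c) *: cl_vec x.
Proof.
have V2 := cl_vec_sqr x; set V := cl_vec x in V2 *; set s := enorm x ^+ 2 in V2 *.
have Z (k l : R) (u v : Cl) : (k *: u) * (l *: v) = (k * l) *: (u * v).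
  by rewrite -scalerAl -scalerAr scalerA.
rewrite [LHS]mulrDl 2![in LHS]mulrDr !Z V2 !mul1r !mulr1 scalerN -scaleNr scalerA.
by rewrite !mulNr 2!scalerDl [X in _ + X = _]addrC addrACA.
Qed.

Lemma axialM f g : axial f -> axial g -> axial (fun x => f x * g x).
Proof.
case=> a [b] [ra rb fE] [c] [d] [rc rd gE].
exists (fun r => a r * c r + -1 * (b r * d r) * (r * r)),
       (fun r => a r * d r + b r * c r); split.
- apply: profileD; apply: profileM; [exact: ra | exact: rc | |].
    by apply: profileM; [exact: profile_cst | apply: profileM].
  by apply: profileM; exact: profile_id.
- by apply: profileD; apply: profileM.
move=> x x0; rewrite fE // gE // /axial_form mul_axial.
by congr (_%:A + _); ring.
Qed.

Lemma directionE x : direction x = (enorm x)^-1 *: cl_vec x :> Cl.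
Proof. exact: cl_vecZ. Qed.

(** Multiplication by an invertible scalar preserves divergence, and both
    derivatives then take the default value 0.  Hence the recursion for the
    coefficients can be solved at the origin too, where the axial form gives no
    information. *)
Lemma deriveZ_neq0 (f : pt -> R) (k : R) x v : k != 0 ->
  'D_v (fun y => k * f y) x = k * 'D_v f x.
Proof.
move=> k0; have [df|ndf] := pselect (derivable f x v); first exact: deriveZ.
have D0 (g : pt -> R) : ~ derivable g x v -> 'D_v g x = 0 by exact: dvgP.
rewrite (D0 f ndf) mulr0; apply: D0 => dkf; apply: ndf.
rewrite (_ : f = k^-1 \*: (fun y => k * f y)); first exact: derivableZ.
by apply: funext => y /=; rewrite [_ *: _]mulrA mulVf // mul1r.
Qed.

Lemma dirac_opZ f (k : R) x : k != 0 ->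
  dirac_op (fun y => k *: f y) x = k *: dirac_op f x.
Proof.
move=> k0; rewrite /dirac_op scaler_sumr; apply: eq_bigr => j _.
rewrite scalerAr; congr (_ * _); apply/ffunP => A; rewrite !ffunE.
under eq_fun do rewrite ffunE.
exact: deriveZ_neq0.
Qed.

(** The factors of the weight are the cases [s = -1] and [s = 1]; the parity of
    [atan] and of the sine turns the sign into a factor of the vector part. *)
Lemma axial_ppow (s a : R) : s = 1 \/ s = -1 ->
  axial (fun x => ppow (direction x) (s * enorm x) a).
Proof.
move=> s1.
exists (fun r => (1 + r ^+ 2) `^ (a / 2) * cos (a * atan r)),
  (fun r => s * ((1 + r ^+ 2) `^ (a / 2) * sin (a * atan r) * r^-1)); split.
- by apply: profileM; [exact: profile_pow | exact: profile_cos].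
- apply: profileM; [exact: profile_cst | apply: profileM; last exact: profile_inv].
  by apply: profileM; [exact: profile_pow | exact: profile_sin].
move=> x _; rewrite /ppow /axial_form directionE scalerDr !scalerA.
case: s1 => ->; rewrite ?mul1r // !mulN1r atanN mulrN cosN sinN sqrrN.
by rewrite mulrN mulNr.
Qed.

Lemma axial_weight (a b : R) : axial (weight a b).
Proof.
have := axialM (axial_ppow a (or_intror erefl)) (axial_ppow b (or_introl erefl)).
congr axial; apply: funext => x.
by rewrite /weight mulN1r mul1r.
Qed.

(** Settles the commutation at the origin, the point that the axial form leaves
    out. *)
Lemma weight_origin (a b : R) x : enorm x = 0 -> weight a b x = 1.
Proof.
move=> x0; have p (c : R) : ppow (0 : Cl) 0 c = 1.
  by rewrite /ppow expr0n addr0 powR1 scale1r atan0 mulr0 cos0 scaler0 addr0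
    scale1r.
by rewrite /weight directionE x0 invr0 scale0r oppr0 !p mulr1.
Qed.

Lemma weight_comm_axial (a b : R) f x : axial f ->
  GRing.comm (f x) (weight a b x).
Proof.
move=> [p [q] [_ _ fE]].
have [x0|] := ltrP 0 (enorm x).
  have [c [d] [_ _ wE]] := axial_weight a b.
  rewrite fE // wE // /GRing.comm /axial_form !mul_axial.
  by congr (_%:A + _ *: _); ring.
move=> x0; rewrite weight_origin; first exact: commr1.
by apply/eqP; rewrite eq_le x0 sqrtr_ge0.
Qed.

End AxialFunctions.

(** * Rodrigues' formula *)

(** The recursion given by monogenicity, solved: the factorials cancel against
    the factors [l + 1] of the derivation in [t]. *)
Lemma clifford_jacobi_weighted (R : realType) (m : nat) (a b : R)
    (G : nat -> 'rV[R]_m -> clifford R m) : clifford_jacobi a b G ->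
  forall l x, G l x * weight (a - l%:R) (b - l%:R) x
    = (-1) ^+ l * iter l (@dirac_op R m) (weight a b) x.
Proof.
case=> G0 mono.
have FE l : Fstar G a b l =
    fun x => ((-1) ^+ l / l`!%:R) *: iter l (@dirac_op R m) (weight a b) x.
  elim: l => [|l ih].
    by apply: funext => x; rewrite /Fstar G0 !subr0 fact0 mul1r expr0 divr1 invr1.
  apply: funext => x; have := mono l x.
  rewrite /dt_series /dirac_series ih dirac_opZ; last first.
    by rewrite mulf_neq0 ?signr_eq0 // invr_neq0 // pnatr_eq0 -lt0n fact_gt0.
  move=> /(congr1 ( *:%R l.+1%:R^-1)).
  rewrite scaler0 scalerDr scalerA mulVf ?pnatr_eq0 // scale1r => /eqP.
  rewrite addr_eq0 => /eqP -> /=.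
  rewrite scalerA -scaleNr factS natrM invfM exprS; congr (_ *: _).
  by rewrite mulN1r !mulNr mulrCA.
move=> l x; have /(congr1 (fun F => l`!%:R *: F x)) := FE l.
have l0 : l`!%:R != 0 :> R by rewrite pnatr_eq0 -lt0n fact_gt0.
rewrite /Fstar !scalerA divff // scale1r => ->.
by rewrite mulrCA divff // mulr1 -signr_odd scaler_sign -[in RHS]signr_odd
  mulr_sign.
Qed.

Theorem proposition4p1 (R : realType) (m : nat) (alpha beta : R)
    (G : nat -> 'rV[R]_m -> clifford R m) :
  (1 < m)%N ->
  clifford_jacobi alpha beta G ->
  forall (l : nat) (x : 'rV[R]_m),
    G l x = (-1) ^+ l * weight (l%:R - alpha) (l%:R - beta) x
            * iter l (@dirac_op R m) (weight alpha beta) x.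
Proof.
move=> _ cG l x.
have axl : axial (iter l (@dirac_op R m) (weight alpha beta)).
  by elim: l => [|l ih]; [exact: axial_weight | exact: axial_dirac].
have wN := weightN (alpha - l%:R) (beta - l%:R) x; rewrite !opprB in wN.
have wc := weight_comm_axial (l%:R - alpha) (l%:R - beta) x axl.
set w := weight (l%:R - alpha) (l%:R - beta) x in wN wc *.
have := congr1 (fun u => u * w) (clifford_jacobi_weighted cG l x).
rewrite -[X in X = _ -> _]mulrA wN mulr1 => ->.
by rewrite -[LHS]mulrA -[RHS]mulrA; congr (_ * _).
Qed.
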